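(* Let $K$ be a field of characteristic $0$ and let $(1,R_1,R_2,\dots)$ be a sprout sequence with seed $F(t)\in K[[t]]$, $F(0)=1$. Then $(1,\omega R_1,\omega R_2,\dots)$ is a sprout sequence with seed $\frac{1}{F(-t)}$.
   Context: A sequence $(R_0=1,R_1,R_2,\dots)$ of symmetric functions in $\boldsymbol{x}=(x_1,x_2,\dots)$ is a sprout sequence with seed $F(t)=1+a_1t+\cdots$ if $\sum_{n\ge0}R_nt^n=\prod_{i\ge1}F(x_it)$. $\omega$ is the standard involutive automorphism of the ring of symmetric functions with $\omega(h_n)=e_n$ (equivalently $\omega p_n=(-1)^{n-1}p_n$). *)

(* Defs.v *)
From HB Require Import structures.
From mathcomp Require Import all_boot all_order all_algebra.
From mathcomp Require Import fingroup perm finmap multiset mpoly.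
From mathcomp Require Import boolp classical_sets.

Set Implicit Arguments.
Unset Strict Implicit.
Unset Printing Implicit Defensive.

Import GRing.Theory.

Local Open Scope ring_scope.

Record fps (R : Type) := FPS { fps_coef : nat -> R }.

HB.instance Definition _ (R : Type) := gen_eqMixin (fps R).
HB.instance Definition _ (R : Type) := gen_choiceMixin (fps R).

Lemma fpsP (R : Type) (f g : fps R) : fps_coef f =1 fps_coef g <-> f = g.
Proof.
split=> [|->//]; case: f g => [f] [g] /= fg.
by congr FPS; apply: funext.
Qed.

Section FpsRing.
Variable R : comNzRingType.
Implicit Types f g h : fps R.

Definition fps_zero : fps R := FPS (fun=> 0).
Definition fps_one : fps R := FPS (fun n => (n == 0)%:R).
Definition fps_opp f := FPS (fun n => - fps_coef f n).
Definition fps_add f g := FPS (fun n => fps_coef f n + fps_coef g n).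
Definition fps_mul f g :=
  FPS (fun n => \sum_(i < n.+1) fps_coef f i * fps_coef g (n - i)).

Fact fps_addA : associative fps_add.
Proof. by move=> f g h; apply/fpsP => n /=; rewrite addrA. Qed.
Fact fps_addC : commutative fps_add.
Proof. by move=> f g; apply/fpsP => n /=; rewrite addrC. Qed.
Fact fps_add0 : left_id fps_zero fps_add.
Proof. by move=> f; apply/fpsP => n /=; rewrite add0r. Qed.
Fact fps_addN : left_inverse fps_zero fps_opp fps_add.
Proof. by move=> f; apply/fpsP => n /=; rewrite addNr. Qed.

HB.instance Definition _ :=
  GRing.isZmodule.Build (fps R) fps_addA fps_addC fps_add0 fps_addN.

Fact fps_mulC : commutative fps_mul.
Proof.
move=> f g; apply/fpsP => n /=; rewrite (reindex_inj rev_ord_inj) /=.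
by apply: eq_bigr => i _; rewrite mulrC subSS subKn // -ltnS.
Qed.

Fact fps_mulA : associative fps_mul.
Proof.
have mulrev f g n : fps_coef (fps_mul f g) n =
    \sum_(i < n.+1) fps_coef f (n - i) * fps_coef g i.
  by rewrite fps_mulC; apply: eq_bigr => i _; rewrite mulrC.
move=> f g h; apply/fpsP => n; rewrite [RHS]mulrev.
pose c j k := fps_coef f j * (fps_coef g (n - j - k) * fps_coef h k).
transitivity (\sum_(j < n.+1) \sum_(k < n.+1 | (k <= n - j)%N) c j k).
  apply: eq_bigr => j _; rewrite -/(fps_coef (fps_mul g h) _) mulrev big_distrr /=.
  by rewrite (big_ord_narrow_leq (leq_subr _ _)).
rewrite (exchange_big_dep predT) //=; apply: eq_bigr => k _.
transitivity (\sum_(j < n.+1 | (j <= n - k)%N) c j k).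
  apply: eq_bigl => j; rewrite -ltnS -(ltnS j) -!subSn ?leq_ord //.
  by rewrite -subn_gt0 -(subn_gt0 j) -!subnDA addnC.
rewrite (big_ord_narrow_leq (leq_subr _ _)) big_distrl /=.
by apply: eq_bigr => j _; rewrite /c -!subnDA addnC mulrA.
Qed.

Fact fps_mul1 : left_id fps_one fps_mul.
Proof.
move=> f; apply/fpsP => n /=; rewrite big_ord_recl subn0 mul1r big1 ?addr0 //.
by move=> i _; rewrite mul0r.
Qed.

Fact fps_mulDl : left_distributive fps_mul fps_add.
Proof.
move=> f g h; apply/fpsP => n /=; rewrite -big_split.
by apply: eq_bigr => i _; rewrite mulrDl.
Qed.

Fact fps_one_neq0 : fps_one != 0.
Proof.
apply/eqP => /(congr1 (fun f => fps_coef f 0)) /eqP /=.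
by rewrite oner_eq0.
Qed.

HB.instance Definition _ := GRing.Zmodule_isComNzRing.Build (fps R)
  fps_mulA fps_mulC fps_mul1 fps_mulDl fps_one_neq0.

Lemma fps_coef1 n : fps_coef (1 : fps R) n = (n == 0)%:R.
Proof. by []. Qed.

Lemma fps_coefM f g n :
  fps_coef (f * g) n = \sum_(i < n.+1) fps_coef f i * fps_coef g (n - i).
Proof. by []. Qed.

Definition fps_unit : pred (fps R) := fun f => `[< exists g, g * f = 1 >].
Definition fps_inv (f : fps R) : fps R := xget f [set g | g * f = 1]%classic.

Fact fps_mulV : {in fps_unit, left_inverse 1 fps_inv *%R}.
Proof. by move=> f /asboolP[g gf]; rewrite /fps_inv; case: xgetP => [h _|/(_ g)]. Qed.

Fact fps_unitPl f g : g * f = 1 -> fps_unit f.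
Proof. by move=> gf; apply: asboolT; exists g. Qed.

Fact fps_inv_out : {in [predC fps_unit], fps_inv =1 id}.
Proof.
move=> f /negP nf; rewrite /fps_inv; case: xgetP => // h _ hf.
by case: nf; apply: fps_unitPl hf.
Qed.

HB.instance Definition _ := GRing.ComNzRing_hasMulInverse.Build (fps R)
  fps_mulV fps_unitPl fps_inv_out.

End FpsRing.

Definition fps_negvar (R : comNzRingType) (F : fps R) : fps R :=
  FPS (fun n => (-1) ^+ n * fps_coef F n).

Definition fps_scalevar (R : comNzRingType) (A : comAlgType R) (c : A)
    (F : fps R) : fps A :=
  FPS (fun n => fps_coef F n *: c ^+ n).

Lemma fps_unitE (R : comUnitRingType) (F : fps R) :
  (F \is a GRing.unit) = (fps_coef F 0 \is a GRing.unit).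
Proof.
apply/idP/idP => [/mulVr /(congr1 (fun f => fps_coef f 0))|F0].
  rewrite fps_coefM big_ord1 fps_coef1 => e; apply/unitrPr.
  by exists (fps_coef F^-1 0); rewrite mulrC.
pose u := (fps_coef F 0)^-1.
pose step s := - u * \sum_(i < size s) fps_coef F i.+1 * s`_(size s - i.+1).
pose s := fix s n := if n is m.+1 then rcons (s m) (step (s m)) else [:: u].
have size_s n : size (s n) = n.+1 by elim: n => //= n IH; rewrite size_rcons IH.
have s_nth m n : (m <= n)%N -> (s n)`_m = (s m)`_m.
  elim: n => [|n IH]; first by rewrite leqn0 => /eqP ->.
  rewrite leq_eqVlt => /orP[/eqP -> //|]; rewrite ltnS => mn.
  by rewrite /= nth_rcons size_s ltnS mn IH.
apply/unitrPr; exists (FPS (fun n => (s n)`_n)); apply/fpsP => -[|n].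
  by rewrite fps_coefM big_ord1 /= /u divrr.
rewrite fps_coefM big_ord_recl /= subn0 nth_rcons size_s ltnn eqxx /step size_s.
rewrite mulrA mulrN /u divrr // mulN1r addrC.
apply/eqP; rewrite subr_eq0; apply/eqP; apply: eq_bigr => i _.
by rewrite /bump /= add1n subSS (s_nth (n - i)%N n) ?leq_subr.
Qed.

(* The monomial \prod_i x_i ^ (A i) is represented by the finite multiset A of
   the indices of its variables; products of monomials are sums of multisets,
   and the degree of A is size A. *)

Notation monom := {mset nat}%mset.

Definition submsets (A : monom) : seq monom :=
  undup [seq seq_mset (mask b A) | b : (size A).-tuple bool].

Lemma mem_submsets (A B : monom) : (B \in submsets A) = (B `<=` A)%mset.
Proof.
rewrite mem_undup; apply/mapP/idP => [[b _ ->]|/msubsetP BA].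
  apply/msubsetP => x; rewrite mset_seqE -count_mem_mset.
  exact/leq_count_subseq/mask_subseq.
have /count_subseqP[s /subseqP[b sb ->] Bs] : forall x,
    (count_mem x (B : seq nat) <= count_mem x (A : seq nat))%N.
  by move=> x; rewrite !count_mem_mset.
exists (tcast sb (in_tuple b)); rewrite ?mem_enum // val_tcast /= -[LHS]seq_mset_id.
exact/eq_seq_msetP.
Qed.

(* R[[x_0, x_1, ...]] *)
Record mfps (R : Type) := MFPS { mcf : monom -> R }.

HB.instance Definition _ (R : Type) := gen_eqMixin (mfps R).
HB.instance Definition _ (R : Type) := gen_choiceMixin (mfps R).

Lemma mfpsP (R : Type) (f g : mfps R) : mcf f =1 mcf g <-> f = g.
Proof.
split=> [|->//]; case: f g => [f] [g] /= fg.
by congr MFPS; apply: funext.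
Qed.

Section MfpsRing.
Variable R : comNzRingType.
Implicit Types (f g h : mfps R) (A B : monom) (c : R).

Definition mfps_zero : mfps R := MFPS (fun=> 0).
Definition mfps_one : mfps R := MFPS (fun A => (A == mset0)%:R).
Definition mfps_opp f := MFPS (fun A => - mcf f A).
Definition mfps_add f g := MFPS (fun A => mcf f A + mcf g A).
Definition mfps_scale c f := MFPS (fun A => c * mcf f A).
Definition mfps_mul f g :=
  MFPS (fun A => \sum_(B <- submsets A) mcf f B * mcf g (A `\` B)%mset).

Fact mfps_addA : associative mfps_add.
Proof. by move=> f g h; apply/mfpsP => n /=; rewrite addrA. Qed.
Fact mfps_addC : commutative mfps_add.
Proof. by move=> f g; apply/mfpsP => n /=; rewrite addrC. Qed.
Fact mfps_add0 : left_id mfps_zero mfps_add.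
Proof. by move=> f; apply/mfpsP => n /=; rewrite add0r. Qed.
Fact mfps_addN : left_inverse mfps_zero mfps_opp mfps_add.
Proof. by move=> f; apply/mfpsP => n /=; rewrite addNr. Qed.

HB.instance Definition _ :=
  GRing.isZmodule.Build (mfps R) mfps_addA mfps_addC mfps_add0 mfps_addN.

Lemma mfps_mulE f g A (D : seq monom) : uniq D ->
    (forall B, (B `<=` A)%mset -> B \in D) ->
  mcf (mfps_mul f g) A =
  \sum_(B <- D) \sum_(C <- D | (B `+` C)%mset == A) mcf f B * mcf g C.
Proof.
move=> uD AD /=.
rewrite [RHS](bigID (fun B => B `<=` A)%mset) /= [X in _ + X]big1 ?addr0; last first.
  move=> B nBA; rewrite big1 // => C /eqP e; case/negP: nBA.
  by rewrite -e; apply/msubsetP => x; rewrite msetE2 leq_addr.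
rewrite (perm_big [seq B <- D | (B `<=` A)%mset]) /=; last first.
  apply: uniq_perm; [exact: undup_uniq | exact: filter_uniq | move=> B].
  rewrite mem_submsets mem_filter.
  by case: (boolP (B `<=` A)%mset) => //= /AD ->.
rewrite big_filter; apply: eq_bigr => B BA.
rewrite -big_filter (perm_big [:: (A `\` B)%mset]) ?big_seq1 //.
apply: uniq_perm; rewrite ?filter_uniq // => C; rewrite mem_filter inE.
have BAx x := (elimT msubsetP BA) x.
apply/andP/eqP => [[/eqP <- _]|->]; first by apply/msetP => x; rewrite !msetE2 addKn.
split; first by apply/eqP/msetP => x; rewrite !msetE2 subnKC.
by apply: AD; apply/msubsetP => x; rewrite msetE2 leq_subr.
Qed.

Fact mfps_mulC : commutative mfps_mul.
Proof.
move=> f g; apply/mfpsP => A.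
have uD := undup_uniq _ : uniq (submsets A).
have AD B : (B `<=` A)%mset -> B \in submsets A by rewrite mem_submsets.
rewrite !(mfps_mulE _ _ uD AD).
rewrite (exchange_big_dep predT) //=; apply: eq_bigr => B _.
by apply: eq_big => C; [rewrite msetDC | rewrite mulrC].
Qed.

Fact mfps_mulA : associative mfps_mul.
Proof.
suff H f g h A : mcf (mfps_mul (mfps_mul f g) h) A =
    \sum_(B <- submsets A) \sum_(C <- submsets A)
      \sum_(E <- submsets A | (B `+` C `+` E)%mset == A)
        mcf f B * mcf g C * mcf h E.
  move=> f g h; apply/mfpsP => A; rewrite mfps_mulC 2!H.
  under eq_bigr do under eq_bigr do rewrite big_mkcond /=.
  under eq_bigr do rewrite exchange_big /=.
  rewrite exchange_big /=; apply: eq_bigr => E _; apply: eq_bigr => B _.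
  rewrite [RHS]big_mkcond; apply: eq_bigr => C _.
  by rewrite [(B `+` C `+` E)%mset]msetDC msetDA [_ * mcf f E]mulrC mulrA.
have uD := undup_uniq _ : uniq (submsets A).
have AD B : (B `<=` A)%mset -> B \in submsets A by rewrite mem_submsets.
rewrite (mfps_mulE _ _ uD AD); set D := submsets A.
transitivity (\sum_(F <- D) \sum_(E <- D | (F `+` E)%mset == A)
    \sum_(B <- D) \sum_(C <- D | (B `+` C)%mset == F)
      mcf f B * mcf g C * mcf h E).
  apply: eq_big_seq => F FD; apply: eq_bigr => E _.
  rewrite (mfps_mulE f g uD) => [|B BF].
    by rewrite mulr_suml; apply: eq_bigr => B _; rewrite mulr_suml.
  rewrite mem_submsets in FD; rewrite mem_submsets.
  apply/msubsetP => x.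
  exact: leq_trans (elimT msubsetP BF x) (elimT msubsetP FD x).
under eq_bigr do rewrite exchange_big /=.
rewrite exchange_big /=; apply: eq_bigr => B _.
under eq_bigr do under eq_bigr do rewrite big_mkcond /=.
under eq_bigr do rewrite exchange_big /=.
rewrite exchange_big /=; apply: eq_bigr => C _.
under eq_bigr do rewrite big_mkcond /=.
rewrite exchange_big [RHS]big_mkcond /=; apply: eq_bigr => E _.
case: eqP => [e|ne].
  rewrite (bigD1_seq (B `+` C)%mset) //=.
    rewrite e !eqxx big1 ?addr0 // => F nF.
    rewrite [(B `+` C)%mset == F]eq_sym (negbTE nF).
    by case: ifP.
  by rewrite AD // -e; apply/msubsetP => x; rewrite [X in (_ <= X)%N]msetE2 leq_addr.
apply: big1 => F _; case: ifP => // /eqP FE; case: eqP => // BC.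
by case: ne; rewrite BC.
Qed.

Fact mfps_mul1 : left_id mfps_one mfps_mul.
Proof.
move=> f; apply/mfpsP => A /=.
rewrite (bigD1_seq mset0) /=; last 2 first.
- by rewrite mem_submsets; apply/msubsetP => x; rewrite mset0E.
- exact: undup_uniq.
rewrite eqxx mul1r big1 => [|B /negbTE ->]; last by rewrite mul0r.
by rewrite addr0; congr mcf; apply/msetP => x; rewrite msetE2 mset0E subn0.
Qed.

Fact mfps_mulDl : left_distributive mfps_mul mfps_add.
Proof.
move=> f g h; apply/mfpsP => n /=; rewrite -big_split.
by apply: eq_bigr => i _; rewrite mulrDl.
Qed.

Fact mfps_one_neq0 : mfps_one != 0.
Proof.
apply/eqP => /(congr1 (fun f => mcf f mset0)) /eqP /=.
by rewrite eqxx oner_eq0.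
Qed.

HB.instance Definition _ := GRing.Zmodule_isComNzRing.Build (mfps R)
  mfps_mulA mfps_mulC mfps_mul1 mfps_mulDl mfps_one_neq0.

Fact mfps_scaleA a b f : mfps_scale a (mfps_scale b f) = mfps_scale (a * b) f.
Proof. by apply/mfpsP => A /=; rewrite mulrA. Qed.
Fact mfps_scale1 : left_id 1 mfps_scale.
Proof. by move=> f; apply/mfpsP => A /=; rewrite mul1r. Qed.
Fact mfps_scaleDr : right_distributive mfps_scale +%R.
Proof. by move=> c f g; apply/mfpsP => A /=; rewrite mulrDr. Qed.
Fact mfps_scaleDl f : {morph mfps_scale^~ f : a b / a + b}.
Proof. by move=> a b; apply/mfpsP => A /=; rewrite mulrDl. Qed.

HB.instance Definition _ := GRing.Zmodule_isLmodule.Build R (mfps R)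
  mfps_scaleA mfps_scale1 mfps_scaleDr mfps_scaleDl.

Fact mfps_scaleAl c f g : c *: (f * g) = (c *: f) * g.
Proof.
apply/mfpsP => A /=; rewrite mulr_sumr.
by apply: eq_bigr => B _; rewrite mulrA.
Qed.

HB.instance Definition _ := GRing.Lmodule_isLalgebra.Build R (mfps R) mfps_scaleAl.
HB.instance Definition _ := GRing.Lalgebra_isComAlgebra.Build R (mfps R).

Lemma mcfM f g A :
  mcf (f * g) A = \sum_(B <- submsets A) mcf f B * mcf g (A `\` B)%mset.
Proof. by []. Qed.
Lemma mcf1 A : mcf (1 : mfps R) A = (A == mset0)%:R. Proof. by []. Qed.
Lemma mcf0 A : mcf (0 : mfps R) A = 0. Proof. by []. Qed.
Lemma mcfD f g A : mcf (f + g) A = mcf f A + mcf g A. Proof. by []. Qed.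
Lemma mcfN f A : mcf (- f) A = - mcf f A. Proof. by []. Qed.
Lemma mcfZ c f A : mcf (c *: f) A = c * mcf f A. Proof. by []. Qed.

Definition mfps_var (i : nat) : mfps R :=
  MFPS (fun A => (A == [mset i]%mset)%:R).

End MfpsRing.

Definition monom_perm (s : nat -> nat) (A : monom) : monom :=
  seq_mset [seq s i | i <- A].

Lemma monom_permE s A x : injective s -> monom_perm s A (s x) = A x.
Proof.
move=> s_inj; rewrite mset_seqE count_map -count_mem_mset.
by apply: eq_count => y /=; rewrite inj_eq.
Qed.

Lemma size_monom_perm s A : size (monom_perm s A) = size A.
Proof. by rewrite (perm_size (perm_eq_seq_mset _)) size_map. Qed.

Lemma size_msetD (A B : monom) : size (A `+` B)%mset = (size A + size B)%N.
Proof.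
rewrite -size_cat; apply/perm_size/allP => x _ /=.
by rewrite count_cat !count_mem_mset msetE2.
Qed.

Lemma size_msetB (A B : monom) : (B `<=` A)%mset ->
  size A = (size B + size (A `\` B)%mset)%N.
Proof.
move=> /msubsetP BA; rewrite -size_msetD; congr (size (EnumMset.f _)).
by apply/msetP => x; rewrite !msetE2 subnKC.
Qed.

Section SymFun.
Variable R : comNzRingType.
Implicit Types f g : mfps R.

Definition mfps_symmetric f :=
  forall s : nat -> nat, bijective s ->
  forall A : monom, mcf f (monom_perm s A) = mcf f A.

Definition mfps_bounded f :=
  exists d : nat, forall A : monom, (d < size A)%N -> mcf f A = 0.

Definition symfun_pred : pred (mfps R) :=
  fun f => `[< mfps_symmetric f /\ mfps_bounded f >].

Lemma symfun_predP f :
  reflect (mfps_symmetric f /\ mfps_bounded f) (f \in symfun_pred).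
Proof. exact: asboolP. Qed.

Fact symfun_subalg : GRing.subsemialg_closed symfun_pred.
Proof.
have mset0_perm s A : bijective s -> (monom_perm s A == mset0) = (A == mset0).
  by move=> _; rewrite -!size_mset_eq0 size_monom_perm.
split.
- apply/symfun_predP; split=> [s bs A|]; first by rewrite !mcf1 mset0_perm.
  by exists 0%N => A; rewrite mcf1 -size_mset_eq0 lt0n => /negbTE ->.
- split=> [|f g /symfun_predP[fs [df fb]] /symfun_predP[gs [dg gb]]].
    by apply/symfun_predP; split; [|exists 0%N].
  apply/symfun_predP; split=> [s bs A|]; first by rewrite !mcfD fs ?gs.
  exists (maxn df dg) => A; rewrite gtn_max => /andP[fA gA].
  by rewrite mcfD fb ?gb ?addr0.
- move=> c f /symfun_predP[fs [df fb]]; apply/symfun_predP.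
  split=> [s bs A|]; first by rewrite !mcfZ fs.
  by exists df => A /fb; rewrite mcfZ => ->; rewrite mulr0.
move=> f g /symfun_predP[fs [df fb]] /symfun_predP[gs [dg gb]].
apply/symfun_predP; split=> [s bs A|]; last first.
  exists (df + dg)%N => A dA; rewrite mcfM big1_seq // => B /andP[_].
  rewrite mem_submsets => /size_msetB e; have [fB|Bf] := ltnP df (size (B : monom)).
    by rewrite fb ?mul0r.
  rewrite gb ?mulr0 // -(ltn_add2l (size (B : monom))) -e.
  by apply: leq_ltn_trans dA; rewrite leq_add2r.
have s_inj := bij_inj bs; have [s' s'K sK'] := bs.
have permE' B x : monom_perm s B x = B (s' x).
  by rewrite -[in LHS](sK' x) monom_permE.
rewrite !mcfM (perm_big [seq monom_perm s B | B <- submsets A]).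
  rewrite big_map; apply: eq_bigr => B _; rewrite fs // -[in RHS](gs s) //.
  by congr (_ * mcf g _); apply/msetP => x; rewrite !(msetE2, permE').
apply: uniq_perm; rewrite ?undup_uniq //.
  rewrite map_inj_in_uniq ?undup_uniq // => B C _ _ e.
  by apply/msetP => x; rewrite -(monom_permE B x s_inj) e monom_permE.
move=> B; rewrite mem_submsets; apply/idP/mapP => [/msubsetP BA|[C + ->]].
  exists (monom_perm s' B).
    rewrite mem_submsets; apply/msubsetP => x.
    rewrite -[x]s'K monom_permE; last exact: can_inj sK'.
    by rewrite s'K (leq_trans (BA _)) ?monom_permE.
  apply/msetP => x; rewrite permE' -(monom_permE B x (can_inj sK')) //.
rewrite mem_submsets => /msubsetP CA; apply/msubsetP => x.
by rewrite !permE'.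
Qed.

HB.instance Definition _ :=
  GRing.isSubalgClosed.Build R (mfps R) symfun_pred symfun_subalg.

(* symmetric power series of bounded degree in x_0, x_1, ... *)
Record symfun := SymFun { symfun_val :> mfps R; _ : symfun_val \in symfun_pred }.

HB.instance Definition _ := [isSub for symfun_val].
HB.instance Definition _ := [Choice of symfun by <:].
HB.instance Definition _ := [SubChoice_isSubAlgebra of symfun by <:].
HB.instance Definition _ := [SubNzRing_isSubComNzRing of symfun by <:].

HB.instance Definition _ :=
  GRing.Linear.copy symfun_val (val : symfun -> mfps R).
HB.instance Definition _ :=
  GRing.RMorphism.copy symfun_val (val : symfun -> mfps R).

Lemma symfunP (f g : symfun) : mcf f =1 mcf g <-> f = g.
Proof. by split=> [/mfpsP/val_inj|->]. Qed.

Lemma symfun_sym (f : symfun) : mfps_symmetric f.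
Proof. by case/symfun_predP: (valP f). Qed.
Lemma symfun_bounded (f : symfun) : mfps_bounded f.
Proof. by case/symfun_predP: (valP f). Qed.

Definition symh_mfps (n : nat) : mfps R := MFPS (fun A => (size A == n)%:R).
Definition syme_mfps (n : nat) : mfps R :=
  MFPS (fun A => ((size A == n) && uniq A)%:R).

Fact symh_subproof n : symh_mfps n \in symfun_pred.
Proof.
apply/symfun_predP; split=> [s bs A|] /=; first by rewrite size_monom_perm.
by exists n => A nA; rewrite /= gtn_eqF.
Qed.

Fact syme_subproof n : syme_mfps n \in symfun_pred.
Proof.
apply/symfun_predP; split=> [s bs A|] /=.
  rewrite size_monom_perm (perm_uniq (perm_eq_seq_mset _)).
  by rewrite map_inj_uniq //; apply: bij_inj.
by exists n => A nA; rewrite /= gtn_eqF.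
Qed.

Definition symh n : symfun := SymFun (symh_subproof n).
Definition syme n : symfun := SymFun (syme_subproof n).

End SymFun.

(* By the fundamental theorem, every symmetric function is uniquely a
   polynomial in e_1, e_2, ...; omega evaluates this polynomial at
   h_1, h_2, ...  Up to omega_unique, this constructs the involutive algebra
   automorphism mapping h_n to e_n. *)

Section MpolyEval.
Variables (R : comNzRingType) (n : nat).

Definition mpev (A : comAlgType R) (v : 'I_n -> A) : {mpoly R[n]} -> A :=
  mmap (in_alg A) v.

Lemma mpevX (A : comAlgType R) (v : 'I_n -> A) i : mpev v 'X_i = v i.
Proof. by rewrite /mpev mmapX mmap1U. Qed.

Lemma mpevZ (A : comAlgType R) (v : 'I_n -> A) c p :
  mpev v (c *: p) = c *: mpev v p.
Proof. by rewrite /mpev mmapZ mulr_algl. Qed.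

Lemma mpev_morph (A B : comAlgType R) (phi : {lrmorphism A -> B}) v p :
  phi (mpev v p) = mpev (phi \o v) p.
Proof.
rewrite /mpev /mmap rmorph_sum /=; apply: eq_bigr => m _.
rewrite rmorphM /= rmorph_alg /mmap1 rmorph_prod; congr (_ * _).
by apply: eq_bigr => i _; rewrite rmorphXn.
Qed.

Lemma eq_mpev (A : comAlgType R) (v w : 'I_n -> A) p :
  v =1 w -> mpev v p = mpev w p.
Proof. by move=> /funext ->. Qed.

HB.instance Definition _ (A : comAlgType R) (v : 'I_n -> A) :=
  GRing.RMorphism.copy (mpev v) (mmap (in_alg A) v).
HB.instance Definition _ (A : comAlgType R) (v : 'I_n -> A) :=
  GRing.isScalable.Build R {mpoly R[n]} A *:%R (mpev v) (mpevZ v).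

End MpolyEval.

Lemma mpev_comp (R : comNzRingType) (n k : nat) (t : k.-tuple {mpoly R[n]})
    (p : {mpoly R[k]}) :
  p \mPo t = mpev (tnth t) p.
Proof.
rewrite /comp_mpoly /mpev /mmap; apply: eq_bigr => m _.
by rewrite in_algE alg_mpolyC.
Qed.

Section Truncation.
Variables (R : comNzRingType) (N : nat).

Definition low (A : monom) := all (fun i => i < N)%N A.

Lemma lowP (A : monom) : reflect (forall i, (N <= i)%N -> A i = 0%N) (low A).
Proof.
apply: (iffP allP) => [lowA i Ni|A0 i iA].
  by apply/eqP; rewrite mset_eq0; apply: contraL Ni => /lowA; rewrite -ltnNge.
rewrite ltnNge; apply: contraL iA => /A0/eqP.
by rewrite mset_eq0.
Qed.

Lemma lowD (A B : monom) : low (A `+` B)%mset = low A && low B.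
Proof.
apply/lowP/andP => [AB|[/lowP A0 /lowP B0] i Ni]; last by rewrite msetE2 A0 ?B0.
by split; apply/lowP => i /AB /eqP; rewrite msetE2 addn_eq0 => /andP[/eqP ? /eqP].
Qed.

Definition trunc (f : mfps R) : mfps R :=
  MFPS (fun A => if low A then mcf f A else 0).

Fact trunc_linear : linear trunc.
Proof.
move=> c f g; apply/mfpsP => A; rewrite mcfD mcfZ /=.
by case: ifP => //; rewrite mulr0 addr0.
Qed.

Fact trunc_monoid : monoid_morphism trunc.
Proof.
split; first apply/mfpsP => A /=.
  case: ifP => // /negbT; case: eqP => // ->.
  by rewrite /low enum_mset0.
move=> f g; apply/mfpsP => A /=; case: ifP => lowA.
  apply: eq_big_seq => B; rewrite mem_submsets => /msubsetP BA /=.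
  move: lowA; have {1}-> : A = (B `+` (A `\` B))%mset.
    by apply/msetP => x; rewrite !msetE2 subnKC.
  by rewrite lowD => /andP[-> ->].
apply/esym/big1_seq => B /andP[_]; rewrite mem_submsets => /msubsetP BA /=.
move: lowA; have {1}-> : A = (B `+` (A `\` B))%mset.
  by apply/msetP => x; rewrite !msetE2 subnKC.
by rewrite lowD; case: ifP => [_|]; rewrite ?mul0r //= => ->; rewrite mulr0.
Qed.

HB.instance Definition _ := GRing.isLinear.Build R (mfps R) (mfps R) *:%R trunc
  trunc_linear.
HB.instance Definition _ := GRing.isMonoidMorphism.Build (mfps R) (mfps R) trunc
  trunc_monoid.

Definition mset_of_mnm (m : 'X_{1..N}) : monom :=
  \big[msetD/mset0]_(i < N) msetn (m i) (i : nat).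

Lemma mset_of_mnmE m x :
  mset_of_mnm m x = if insub x is Some i then m i else 0%N.
Proof.
have -> : mset_of_mnm m x = (\sum_(i < N) msetn (m i) (i : nat) x)%N.
  by apply: (big_morph (fun A : monom => A x)) => [A B|]; rewrite ?msetE2 ?mset0E.
case: insubP => [i _ <-|xN].
  rewrite (bigD1 i) //= msetnxx big1 ?addn0 // => j ji.
  by rewrite msetnE eq_sym (inj_eq val_inj) (negbTE ji).
apply: big1 => i _; rewrite msetnE; case: eqP => // xi.
by rewrite xi ltn_ord in xN.
Qed.

Lemma mset_of_mnm_inj : injective mset_of_mnm.
Proof.
move=> m1 m2 e; apply/mnmP => i.
by move/msetP/(_ (i : nat)): e; rewrite !mset_of_mnmE valK.
Qed.

Lemma mset_of_mnmK (A : monom) : low A ->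
  mset_of_mnm [multinom A i | i < N] = A.
Proof.
move=> /lowP A0; apply/msetP => x; rewrite mset_of_mnmE.
case: insubP => [i _ <-|]; first by rewrite mnmE.
by rewrite -leqNgt => /A0 ->.
Qed.

Lemma low_mset_of_mnm m : low (mset_of_mnm m).
Proof.
by apply/lowP => x Nx; rewrite mset_of_mnmE insubF // ltnNge Nx.
Qed.

Lemma size_mset_of_mnm m : size (mset_of_mnm m) = mdeg m.
Proof.
rewrite mdegE /mset_of_mnm.
rewrite (big_morph (fun A : monom => size A) (id1 := 0%N) (op1 := addn)).
- by apply: eq_bigr => i _; rewrite enum_msetn size_nseq.
- exact: size_msetD.
- exact: size_mset0.
Qed.

Definition mfpsX (A : monom) : mfps R := MFPS (fun B => (B == A)%:R).

Lemma mfpsXD (A B : monom) : mfpsX (A `+` B)%mset = mfpsX A * mfpsX B.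
Proof.
apply/mfpsP => C; rewrite mcfM /=; case: eqP => [->|nC].
  rewrite (bigD1_seq A) /=; last 2 first.
  - by rewrite mem_submsets; apply/msubsetP => x; rewrite msetE2 leq_addr.
  - exact: undup_uniq.
  rewrite eqxx mul1r big1 ?addr0 => [|E /negbTE ->]; last by rewrite mul0r.
  have -> : ((A `+` B) `\` A = B)%mset by apply/msetP => x; rewrite !msetE2 addKn.
  by rewrite eqxx.
apply/esym/big1_seq => E /andP[_]; rewrite mem_submsets => /msubsetP EC.
case: eqP => [EA|]; last by rewrite mul0r.
case: eqP => [CE|]; last by rewrite mulr0.
case: nC; rewrite -EA -CE; apply/msetP => x.
by rewrite !msetE2 subnKC.
Qed.

Lemma mfpsX0 : mfpsX mset0 = 1. Proof. exact/mfpsP. Qed.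

Lemma mfpsXn i k : mfpsX (msetn k i) = mfps_var R i ^+ k.
Proof.
elim: k => [|k IH]; first by rewrite msetn0 mfpsX0.
rewrite exprS -IH -[mfps_var R i]/(mfpsX [mset i]%mset) -mfpsXD.
by congr mfpsX; apply/msetP => x; rewrite msetE2 !msetnE; case: eqP.
Qed.

Definition mpevx : {mpoly R[N]} -> mfps R := mpev (fun i : 'I_N => mfps_var R i).
HB.instance Definition _ := GRing.LRMorphism.on mpevx.

Lemma mcf_mpevx p A : mcf (mpevx p) A =
  if low A then p@_[multinom A i | i < N] else 0.
Proof.
have -> : mpevx p = \sum_(m <- msupp p) p@_m *: mfpsX (mset_of_mnm m).
  apply: eq_bigr => m _; rewrite mulr_algl; congr (_ *: _).
  rewrite /mmap1 /mset_of_mnm (big_morph _ mfpsXD mfpsX0).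
  by apply: eq_bigr => i _; rewrite mfpsXn.
rewrite (big_morph (fun f => mcf f A) (id1 := 0) (op1 := +%R)) //.
case: ifP => lowA.
  set m := [multinom _ | _ < _]; rewrite (eq_bigr (fun k => p@_k * (k == m)%:R)).
    have [mp|mp] := boolP (m \in msupp p).
      rewrite (bigD1_seq m) ?msupp_uniq //= eqxx mulr1 big1 ?addr0 //.
      by move=> k /negbTE ->; rewrite mulr0.
    rewrite memN_msupp_eq0 // big1_seq // => k /andP[_ kp].
    by case: eqP kp mp => [->|_ _]; rewrite ?mulr0 // => ->.
  move=> k _ /=; rewrite -{1}(mset_of_mnmK lowA) (inj_eq mset_of_mnm_inj).
  by rewrite eq_sym.
apply: big1 => m _ /=; case: eqP => [e|]; last by rewrite mulr0.
by rewrite e low_mset_of_mnm in lowA.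
Qed.

Lemma mpevx_inj : injective mpevx.
Proof.
move=> p q e; apply/mpolyP => m.
have := congr1 (fun f => mcf f (mset_of_mnm m)) e.
rewrite !mcf_mpevx low_mset_of_mnm (_ : [multinom _ | _ < _] = m) //.
by apply/mset_of_mnm_inj/mset_of_mnmK/low_mset_of_mnm.
Qed.

Lemma uniq_msetP (A : monom) : reflect (forall x, A x <= 1)%N (uniq A).
Proof.
apply: (iffP idP) => [uA x|A1].
  by rewrite -count_mem_mset count_uniq_mem ?leq_b1.
apply: count_mem_uniq => x; rewrite count_mem_mset.
by have := A1 x; rewrite in_mset; case: (A x) => [|[|]].
Qed.

Lemma trunc_syme k : trunc (syme R k) = mpevx (mesym N R k).
Proof.
apply/mfpsP => A; rewrite mcf_mpevx /=; case: ifP => // lowA.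
rewrite mcoeff_mesym /mechar -size_mset_of_mnm mset_of_mnmK //.
congr ((_ && _)%:R); apply/uniq_msetP/forallP => A1 x.
  by rewrite mnmE.
have [xN|] := ltnP x N; last by move/lowP: lowA => /[apply] ->.
by have := A1 (Ordinal xN); rewrite mnmE.
Qed.

Definition mpeve : {mpoly R[N]} -> symfun R :=
  mpev (fun i : 'I_N => syme R i.+1).
HB.instance Definition _ := GRing.LRMorphism.on mpeve.

Lemma trunc_mpeve T :
  trunc (mpeve T) = mpevx (T \mPo [tuple mesym N R i.+1 | i < N]).
Proof.
rewrite mpev_comp [RHS](mpev_morph mpevx) /mpeve.
rewrite (mpev_morph (@symfun_val R)).
rewrite (mpev_morph trunc); apply: eq_mpev => i /=.
by rewrite trunc_syme tnth_map tnth_ord_tuple.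
Qed.

Lemma mpeve_inj : injective mpeve.
Proof.
move=> T1 T2 e; apply: msym_fundamental_un; apply: mpevx_inj.
by rewrite -!trunc_mpeve e.
Qed.

End Truncation.

Section Generation.
Variable R : comNzRingType.

Definition degle d (f : mfps R) := forall A : monom, (d < size A)%N -> mcf f A = 0.

Lemma degle_le c d f : (c <= d)%N -> degle c f -> degle d f.
Proof. by move=> cd fc A dA; apply: fc; apply: leq_ltn_trans dA. Qed.

Lemma degleM c d f g : degle c f -> degle d g -> degle (c + d) (f * g).
Proof.
move=> fc gd A dA; rewrite mcfM big1_seq // => B /andP[_].
rewrite mem_submsets => /size_msetB e.
have [fB|Bf] := ltnP c (size (B : monom)); first by rewrite fc ?mul0r.
rewrite gd ?mulr0 // -(ltn_add2l (size (B : monom))) -e.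
by apply: leq_ltn_trans dA; rewrite leq_add2r.
Qed.

Lemma degle1 : degle 0 1.
Proof. by move=> A; rewrite mcf1 -size_mset_eq0 lt0n => /negbTE ->. Qed.

Lemma degleX d f k : degle d f -> degle (k * d) (f ^+ k).
Proof.
move=> fd; elim: k => [|k IH]; first exact: degle1.
by rewrite exprS mulSn; apply: degleM.
Qed.

Lemma degle_mpeve N (T : {mpoly R[N]}) d :
  (mweight T <= d.+1)%N -> degle d (mpeve T).
Proof.
move=> wT A dA; rewrite /mpeve (mpev_morph (@symfun_val R)) /mpev /mmap.
rewrite (big_morph (fun f => mcf f A) (id1 := 0) (op1 := +%R)) //.
apply: big1_seq => m /andP[_ mT]; rewrite mulr_algl mcfZ.
suff /(_ A dA) -> : degle d (mmap1 (@symfun_val R \o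
    (fun i : 'I_N => syme R i.+1)) m) by rewrite mulr0.
have wm : (mnmwgt m <= d)%N by rewrite -ltnS (leq_trans (mmeasure_mnm_lt _ mT)).
apply: degle_le wm _; rewrite /mmap1 /mnmwgt.
elim/big_rec2: _ => [|i c f _ fc]; first exact: degle1.
by apply: degleM fc; apply: degleX => B; rewrite /= => /gtn_eqF ->.
Qed.

Definition swapn (a b x : nat) :=
  if x == a then b else if x == b then a else x.

Lemma swapnK a b : involutive (swapn a b).
Proof.
move=> x; rewrite /swapn; case: (eqVneq x a) => [->|xa].
  by case: (eqVneq b a) => [->|_]; rewrite ?eqxx.
case: (eqVneq x b) => [->|xb]; first by rewrite eqxx.
by rewrite (negbTE xa) (negbTE xb).
Qed.

Lemma exists_low N (A : monom) : (size A <= N)%N ->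
  exists2 s, bijective s & low N (monom_perm s A).
Proof.
have [k] := ubnP (count (leq N) A); elim: k A => // k IH A kA AN.
have [lowA|] := boolP (low N A).
  exists id; first by exists id.
  by rewrite /monom_perm map_id seq_mset_id.
case/allPn => a aA; rewrite -leqNgt => Na.
have [b bN bA] : exists2 b, (b < N)%N & b \notin A.
  case: (boolP (all (mem A) (iota 0 N))) => [/allP NA|/allPn[b bN bA]]; last first.
    by exists b; rewrite // mem_iota in bN.
  have /(uniq_leq_size _) : {subset a :: iota 0 N <= A}.
    by move=> x; rewrite inE => /predU1P[->//|/NA].
  rewrite /= iota_uniq mem_iota add0n ltnNge Na => /(_ isT).
  by rewrite size_iota leqNgt ltnS AN.
have [||s bs slow] := IH (monom_perm (swapn a b) A).
- rewrite (seq.permP (perm_eq_seq_mset _)) count_map.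
  rewrite ltnS in kA; apply: leq_trans kA.
  rewrite (eq_in_count (a2 := predI (leq N) (predC1 a))); last first.
    move=> x xA /=; rewrite /swapn; case: eqP => [->|_].
      by rewrite andbF leqNgt bN.
    by case: eqP xA => [->|]; rewrite ?(negbTE bA) ?andbT.
  have -> : count (leq N) A =
      (count_mem a A + count (predI (leq N) (predC1 a)) A)%N.
    rewrite -count_predUI [X in (_ + X)%N](eq_count (a2 := pred0)) ?count_pred0.
      rewrite addn0; apply: eq_count => x /=; case: eqP => [->//|_] /=.
      by rewrite andbT.
    by move=> x /=; case: eqP => //; rewrite andbF.
  by rewrite -addn1 addnC leq_add2r -has_count has_pred1.
- by rewrite size_monom_perm.
exists (s \o swapn a b).
  by apply: bij_comp bs _; exists (swapn a b); apply: swapnK.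
rewrite (_ : monom_perm _ A = monom_perm s (monom_perm (swapn a b) A)) //.
apply/eq_seq_msetP; rewrite (map_comp s (swapn a b)); apply: perm_map.
by rewrite perm_sym; apply: perm_eq_seq_mset.
Qed.

Lemma mpeve_surj (f : symfun R) d N : degle d f -> (d <= N)%N ->
  exists T : {mpoly R[N]}, f = mpeve T.
Proof.
move=> fd dN.
pose p : {mpoly R[N]} :=
  \sum_(m : 'X_{1..N < d.+1}) mcf f (mset_of_mnm m) *: 'X_[m].
have pE m : p@_m = mcf f (mset_of_mnm m).
  have [md|dm] := ltnP (mdeg m) d.+1.
    by rewrite (mcoeff_mpoly (fun m => mcf f (mset_of_mnm m))).
  rewrite fd ?size_mset_of_mnm //; apply: memN_msupp_eq0.
  apply: contraL dm; rewrite -ltnNge => /msupp_sum_le.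
  case/flatten_mapP => m' _ /msuppZ_le; rewrite msuppX inE => /eqP ->.
  exact: bmdeg.
have psym : p \is symmetric.
  apply/issymP => s; apply/mpolyP => m; rewrite mcoeff_sym !pE.
  pose ext (t : 'S_N) (x : nat) := if insub x is Some i then val (t i) else x.
  have extK t : cancel (ext t) (ext t^-1%g).
    move=> x; rewrite {2}/ext; case: insubP => [i _ xi|xN].
      by rewrite /ext valK permK xi.
    by rewrite /ext insubN.
  have extE t (i : 'I_N) : ext t i = t i by rewrite /ext valK.
  have bext : bijective (ext s).
    by exists (ext s^-1%g) => // x; have := extK s^-1%g x; rewrite invgK.
  rewrite -(symfun_sym f bext); congr mcf; apply/msetP => x.
  have [y ->] : exists y, x = ext s y by case: bext => g _ gK; exists (g x).
  rewrite monom_permE; last exact: bij_inj.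
  rewrite [LHS]mset_of_mnmE; case: insubP => [i _ yi|yN].
    by rewrite mnmE -yi extE mset_of_mnmE valK.
  by rewrite /ext insubN // mset_of_mnmE insubN.
have [T [Tp wT]] := sym_fundamental psym.
exists T; apply/symfunP => A.
have [Ad|dA] := leqP (size A) d; last first.
  rewrite fd // (@degle_mpeve _ _ d) // (leq_trans wT) // /p.
  rewrite (leq_trans (mmeasure_sum _ _ _ _)) //; apply/bigmax_leqP => m _.
  by rewrite (leq_trans (mmeasureZ_le _ _ _)) // mmeasureX; apply: bmdeg.
have [s bs lowA] := exists_low (leq_trans Ad dN).
rewrite -(symfun_sym f bs) -(symfun_sym (mpeve T) bs).
have := congr1 (fun g => mcf g (monom_perm s A)) (trunc_mpeve T).
by rewrite /= lowA => ->; rewrite Tp mcf_mpevx lowA pE mset_of_mnmK.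
Qed.

End Generation.

Section OmegaConstruction.
Variable R : comNzRingType.

Lemma syme0 : syme R 0 = 1.
Proof.
apply/symfunP => A; rewrite mcf1 /= -size_mset_eq0.
by case: eqP => // /size0nil ->.
Qed.

Lemma symh0 : symh R 0 = 1.
Proof. by apply/symfunP => A; rewrite mcf1 /= -size_mset_eq0. Qed.

Lemma symfun_mcfM (f g : symfun R) A : mcf (f * g) A =
  \sum_(B <- submsets A) mcf f B * mcf g (A `\` B)%mset.
Proof. by rewrite -mcfM -rmorphM. Qed.

Lemma syme_symh n : (0 < n)%N ->
  \sum_(k < n.+1) (-1) ^+ k *: (syme R k * symh R (n - k)) = 0.
Proof.
move=> n0; apply/symfunP => A.
rewrite (big_morph (fun f : symfun R => mcf f A) (id1 := 0) (op1 := +%R)) //.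
transitivity (\sum_(B <- submsets A | uniq (B : monom))
    (-1) ^+ size (B : monom) * ((size A == n)%:R : R)).
  under eq_bigr => k _ do rewrite linearZ mcfZ symfun_mcfM mulr_sumr.
  rewrite exchange_big [RHS]big_mkcond; apply: eq_big_seq => B.
  rewrite mem_submsets => /size_msetB AB /=.
  case: ifP => uB; last first.
    by apply: big1 => k _; rewrite andbF mul0r mulr0.
  have [Bn|nB] := ltnP (size (B : monom)) n.+1.
    rewrite (bigD1 (Ordinal Bn)) //= eqxx mul1r big1 ?addr0 => [|k].
      by congr (_ * _%:R); rewrite AB -[in RHS](subnKC (ltnSE Bn)) eqn_add2l.
    rewrite -val_eqE eq_sym /= => /negbTE ->.
    by rewrite mul0r mulr0.
  rewrite big1 => [|k _]; last first.
    by rewrite gtn_eqF ?mul0r ?mulr0 // (leq_trans (ltn_ord k)).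
  by rewrite gtn_eqF ?mulr0 // AB ltn_addr.
rewrite -mulr_suml; case: eqP => [An|]; last by rewrite mulr0.
rewrite mulr1; have [a aA] : exists a, a \in A.
  by move: An n0; rewrite -[size A]/(size (A : seq nat)) => <-; rewrite -has_predT => /hasP[a]; exists a.
rewrite (bigID (fun B : monom => a \in B)) /= addrC; apply/eqP.
rewrite addr_eq0 -sumrN; apply/eqP.
rewrite -big_filter -[RHS]big_filter.
set U0 := [seq B <- _ | _]; set U1 := [seq B <- _ | _].
rewrite [RHS](perm_big [seq (a +` B)%mset | B <- U0]).
  rewrite big_map; apply: eq_big_seq => B _.
  by rewrite size_msetD enum_msetn /= exprS mulN1r opprK.
have aD (B : monom) : a \notin B -> (uniq (a +` B)%mset = uniq B).
  move=> aB; rewrite -[RHS]andTb -aB -[RHS]/(uniq (a :: B)); apply: perm_uniq.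
  apply/allP => x _ /=; rewrite count_mem_mset mset1DE count_mem_mset.
  by rewrite [a == x]eq_sym.
apply: uniq_perm; rewrite ?filter_uniq ?undup_uniq //.
  rewrite map_inj_uniq ?filter_uniq ?undup_uniq // => B C /(congr1 (fun D => D `\ a)%mset).
  by rewrite !msetD1K.
move=> B; rewrite mem_filter mem_submsets; apply/andP/mapP.
  move=> [/andP[uB aB] BA]; exists (B `\ a)%mset; last by rewrite msetB1K.
  have aB' : a \notin (B `\ a)%mset.
    by rewrite msetB11 -leqNgt (uniq_msetP _ uB).
  rewrite mem_filter aB' -(aD _ aB') msetB1K // uB mem_submsets.
  by apply: msubset_trans BA; apply/msubsetP => x; rewrite msetE2 leq_subr.
move=> [C]; rewrite mem_filter mem_submsets => /andP[/andP[uC aC] CA] ->.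
rewrite aD // uC in_mset1D eqxx; split=> //; apply/msubsetP => x.
rewrite mset1DE; case: eqP => [->|_]; last exact: (elimT msubsetP CA).
by move: aC aA; rewrite -mset_eq0 in_mset => /eqP ->.
Qed.

Lemma mpev_widen n k (nk : (n <= k)%N) (A : comAlgType R) (v : nat -> A)
    (p : {mpoly R[n]}) :
  mpev (fun i : 'I_n => v i) p =
  mpev (fun i : 'I_k => v i) (mpev (fun i : 'I_n => 'X_(widen_ord nk i)) p).
Proof.
rewrite [RHS](mpev_morph (mpev (fun i : 'I_k => v i))).
by apply: eq_mpev => i /=; rewrite mpevX.
Qed.

Definition mpevh n : {mpoly R[n]} -> symfun R :=
  mpev (fun i : 'I_n => symh R i.+1).
HB.instance Definition _ n := GRing.LRMorphism.on (@mpevh n).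

Lemma mpeve_mpevh m n (T : {mpoly R[m]}) (U : {mpoly R[n]}) :
  mpeve T = mpeve U -> mpevh T = mpevh U.
Proof.
rewrite /mpeve /mpevh.
rewrite !(mpev_widen (leq_maxl m n) (fun i => syme R i.+1)).
rewrite !(mpev_widen (leq_maxr m n) (fun i => syme R i.+1)).
rewrite (mpev_widen (leq_maxl m n) (fun i => symh R i.+1)).
rewrite (mpev_widen (leq_maxr m n) (fun i => symh R i.+1)).
by move=> /mpeve_inj ->.
Qed.

Definition omega_graph (f g : symfun R) :=
  exists n, exists2 T : {mpoly R[n]}, f = mpeve T & g = mpevh T.

Lemma omega_graph_ex f : exists g, omega_graph f g.
Proof.
have [d fd] := symfun_bounded f; have [T fT] := mpeve_surj fd (leqnn d).
by exists (mpevh T), d, T.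
Qed.

Definition omega_fun f := projT1 (cid (omega_graph_ex f)).

Lemma omega_mpeve n (T : {mpoly R[n]}) : omega_fun (mpeve T) = mpevh T.
Proof.
rewrite /omega_fun; have [m [U TU ->]] := projT2 (cid (omega_graph_ex (mpeve T))).
exact/esym/mpeve_mpevh.
Qed.

Lemma symfun_mpeve2 f g : exists n (T U : {mpoly R[n]}),
  f = mpeve T /\ g = mpeve U.
Proof.
have [c fc] := symfun_bounded f; have [d gd] := symfun_bounded g.
have [T fT] := mpeve_surj fc (leq_maxl c d).
have [U gU] := mpeve_surj gd (leq_maxr c d).
by exists (maxn c d), T, U.
Qed.

Fact omega_linear : linear omega_fun.
Proof.
move=> c f g; have [n [T [U [-> ->]]]] := symfun_mpeve2 f g.
by rewrite -linearP !omega_mpeve linearP.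
Qed.

Fact omega_monoid : monoid_morphism omega_fun.
Proof.
split; first by rewrite -(rmorph1 (@mpeve R 0)) omega_mpeve !rmorph1.
move=> f g; have [n [T [U [-> ->]]]] := symfun_mpeve2 f g.
by rewrite -rmorphM !omega_mpeve rmorphM.
Qed.

HB.instance Definition _ := GRing.isLinear.Build R (symfun R) (symfun R) *:%R
  omega_fun omega_linear.
HB.instance Definition _ := GRing.isMonoidMorphism.Build (symfun R) (symfun R)
  omega_fun omega_monoid.

Definition omega : {lrmorphism symfun R -> symfun R} := omega_fun.

Lemma omega_syme n : omega (syme R n) = symh R n.
Proof.
case: n => [|n]; first by rewrite syme0 symh0 rmorph1.
have -> : syme R n.+1 = mpeve ('X_(ord_max : 'I_n.+1)) by rewrite /mpeve mpevX.
by rewrite [LHS]omega_mpeve /mpevh mpevX.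
Qed.

Lemma symh_syme n : (0 < n)%N ->
  \sum_(k < n.+1) (-1) ^+ k *: (symh R k * syme R (n - k)) = 0.
Proof.
move=> n0; rewrite (reindex_inj rev_ord_inj) /=.
transitivity ((-1) ^+ n *:
    \sum_(k < n.+1) (-1) ^+ k *: (syme R k * symh R (n - k))); last first.
  by rewrite syme_symh // scaler0.
rewrite scaler_sumr; apply: eq_bigr => k _.
have kn : (k <= n)%N by rewrite -ltnS.
rewrite subSS subKn // scalerA [X in _ *: X]mulrC; congr (_ *: _).
by rewrite -exprD -signr_odd -[in RHS]signr_odd oddB // oddD.
Qed.

Lemma omega_symh n : omega (symh R n) = syme R n.
Proof.
elim/ltn_ind: n => -[_|n IH]; first by rewrite syme0 symh0 rmorph1.
have omegaE k : omega ((-1) ^+ k *: (syme R k * symh R (n.+1 - k))) =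
    (-1) ^+ k *: (symh R k * omega (symh R (n.+1 - k))).
  by rewrite linearZ -[in RHS]omega_syme -rmorphM.
have : \sum_(k < n.+2) (-1) ^+ k *: (symh R k * omega (symh R (n.+1 - k))) =
    \sum_(k < n.+2) (-1) ^+ k *: (symh R k * syme R (n.+1 - k)).
  rewrite [RHS]symh_syme // -(eq_bigr _ (fun (k : 'I_n.+2) _ => omegaE k)).
  by rewrite -rmorph_sum syme_symh // rmorph0.
rewrite big_ord_recl [X in _ = X -> _]big_ord_recl.
rewrite !expr0 !scale1r !subn0 symh0 !mul1r.
rewrite [X in _ + X = _ -> _](eq_bigr (fun i : 'I_n.+1 => (-1) ^+ lift ord0 i *:
  (symh R (lift ord0 i) * syme R (n.+1 - lift ord0 i)))); first exact: addIr.
by move=> k _; rewrite IH // lift0 subSS ltnS leq_subr.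
Qed.

Lemma omegaK : involutive omega.
Proof.
move=> f; have [d fd] := symfun_bounded f.
have [T ->] := mpeve_surj fd (leqnn d).
rewrite [mpeve T]/mpeve (mpev_morph omega) (mpev_morph omega).
by apply: eq_mpev => i /=; rewrite omega_syme omega_symh.
Qed.

Lemma omega_unique (w : {lrmorphism symfun R -> symfun R}) :
  (forall n, w (symh R n) = syme R n) -> w =1 omega.
Proof.
move=> wh f; have [d fd] := symfun_bounded (omega f).
have [T fT] := mpeve_surj fd (leqnn d).
rewrite fT -[f]omegaK fT [omega _]omega_mpeve /mpevh (mpev_morph w).
by apply: eq_mpev => i /=; rewrite wh.
Qed.

End OmegaConstruction.

(* [P] is the formal infinite product \prod_i (u i) in K[[x_0, x_1, ...]][[t]]:
   every coefficient of the finite products is eventually that of [P]. *)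
Definition is_infprod (R : comNzRingType) (u : nat -> fps (mfps R))
    (P : fps (mfps R)) : Prop :=
  forall (n : nat) (A : monom), exists N0 : nat, forall N : nat, (N0 <= N)%N ->
    mcf (fps_coef (\prod_(i < N) u i) n) A = mcf (fps_coef P n) A.

Definition sprout_seq (R : comNzRingType) (F : fps R) (S : nat -> symfun R)
    : Prop :=
  [/\ fps_coef F 0 = 1,
      S 0 = 1 &
      is_infprod (fun i => fps_scalevar (mfps_var R i) F)
                 (FPS (fun n => symfun_val (S n)))].

(* Main.v *)
Require Import Defs.
From HB Require Import structures.
From mathcomp Require Import all_boot all_order all_algebra.
From mathcomp Require Import finmap multiset.

Set Implicit Arguments.
Unset Strict Implicit.
Unset Printing Implicit Defensive.

Import GRing.Theory.
Local Open Scope ring_scope.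

(* Logarithmic differentiation. If R(t) = \prod_i F(x_i t) and
   B(t) = t F'(t) / F(t), then t R'(t) / R(t) = \sum_i B(x_i t)
   = \sum_(k > 0) B_k p_k t^k. For the series E(t) of the e_n and its inverse
   H(-t), this gives Newton's identities, whence omega p_k = - (-1)^k p_k. So
   the logarithmic derivatives of (omega R)(t) and R(-t) are opposite; in
   characteristic 0 the product of these series is therefore 1. As R(-t) has
   seed F(-t), its inverse omega R has seed 1 / F(-t). *)

Lemma scale_signr (R : comNzRingType) (A : comAlgType R) n (a : A) :
  (-1) ^+ n *: a = (-1) ^+ n * a.
Proof. by rewrite -mulr_algl -in_algE rmorph_sign. Qed.

Section CoefficientwiseMorphisms.
Variable R : comNzRingType.
Implicit Types (F G : fps R) (n : nat).

Lemma fps_coefD F G n : fps_coef (F + G) n = fps_coef F n + fps_coef G n.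
Proof. by []. Qed.

Lemma fps_coef_sum I (r : seq I) (P : pred I) (F : I -> fps R) n :
  fps_coef (\sum_(i <- r | P i) F i) n = \sum_(i <- r | P i) fps_coef (F i) n.
Proof. exact: (big_morph (fun F => fps_coef F n)). Qed.

Lemma fps_coef0M F G : fps_coef (F * G) 0 = fps_coef F 0 * fps_coef G 0.
Proof. by rewrite fps_coefM big_ord1. Qed.

Section Map.
Variables (S : comNzRingType) (phi : {rmorphism R -> S}).

Definition fps_map F : fps S := FPS (fun n => phi (fps_coef F n)).

Fact fps_map_zmod_morphism : zmod_morphism fps_map.
Proof. by move=> F G; apply/fpsP => n; rewrite /= rmorphB. Qed.

Fact fps_map_monoid_morphism : monoid_morphism fps_map.
Proof.
split=> [|F G]; apply/fpsP => n /=; first by rewrite rmorph_nat.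
by rewrite rmorph_sum; apply: eq_bigr => i _; rewrite rmorphM.
Qed.

HB.instance Definition _ :=
  GRing.isZmodMorphism.Build (fps R) (fps S) fps_map fps_map_zmod_morphism.
HB.instance Definition _ :=
  GRing.isMonoidMorphism.Build (fps R) (fps S) fps_map fps_map_monoid_morphism.

Lemma fps_map_negvar F : fps_map (fps_negvar F) = fps_negvar (fps_map F).
Proof. by apply/fpsP => n; rewrite /= rmorphM rmorph_sign. Qed.

End Map.

Section ScaleVariable.
Variables (A : comAlgType R) (c : A).

Fact fps_scalevar_zmod_morphism : zmod_morphism (fps_scalevar c).
Proof. by move=> F G; apply/fpsP => n; rewrite /= scalerBl. Qed.

Fact fps_scalevar_monoid_morphism : monoid_morphism (fps_scalevar c).
Proof.
split=> [|F G]; apply/fpsP => n /=.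
  by case: n => [|n]; rewrite ?scale1r ?scale0r.
rewrite scaler_suml; apply: eq_bigr => i _.
by rewrite -scalerAl -scalerAr scalerA -exprD subnKC // -ltnS.
Qed.

HB.instance Definition _ := GRing.isZmodMorphism.Build (fps R) (fps A)
  (fps_scalevar c) fps_scalevar_zmod_morphism.
HB.instance Definition _ := GRing.isMonoidMorphism.Build (fps R) (fps A)
  (fps_scalevar c) fps_scalevar_monoid_morphism.

Lemma fps_scalevar_negvar F :
  fps_scalevar c (fps_negvar F) = fps_negvar (fps_scalevar c F).
Proof. by apply/fpsP => n; rewrite /= -scalerA scale_signr. Qed.

End ScaleVariable.

Lemma fps_scalevar0 (A : comAlgType R) F :
  fps_coef F 0 = 1 -> fps_scalevar (0 : A) F = 1.
Proof.
by move=> F0; apply/fpsP => -[|n]; rewrite /= ?F0 ?scale1r // expr0n scaler0.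
Qed.

Lemma fps_negvarE F : fps_negvar F = fps_scalevar (-1 : R^o) F.
Proof. by apply/fpsP => n; apply: mulrC. Qed.

Fact fps_negvar_zmod_morphism : zmod_morphism (@fps_negvar R).
Proof. by move=> F G; rewrite !fps_negvarE rmorphB. Qed.

Fact fps_negvar_monoid_morphism : monoid_morphism (@fps_negvar R).
Proof. by split=> [|F G]; rewrite !fps_negvarE ?rmorph1 ?rmorphM. Qed.

HB.instance Definition _ := GRing.isZmodMorphism.Build (fps R) (fps R)
  (@fps_negvar R) fps_negvar_zmod_morphism.
HB.instance Definition _ := GRing.isMonoidMorphism.Build (fps R) (fps R)
  (@fps_negvar R) fps_negvar_monoid_morphism.

Lemma fps_negvarK : involutive (@fps_negvar R).
Proof. by move=> F; apply/fpsP => n; rewrite /= signrMK. Qed.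

Definition fps_of_poly (p : {poly R}) : fps R := FPS (fun n => p`_n).

Fact fps_of_poly_zmod_morphism : zmod_morphism fps_of_poly.
Proof. by move=> p q; apply/fpsP => n; rewrite /= coefB. Qed.

Fact fps_of_poly_monoid_morphism : monoid_morphism fps_of_poly.
Proof. by split=> [|p q]; apply/fpsP => n; rewrite /= ?coef1 ?coefM. Qed.

HB.instance Definition _ := GRing.isZmodMorphism.Build {poly R} (fps R)
  fps_of_poly fps_of_poly_zmod_morphism.
HB.instance Definition _ := GRing.isMonoidMorphism.Build {poly R} (fps R)
  fps_of_poly fps_of_poly_monoid_morphism.

Lemma fps_coefXM F n :
  fps_coef (fps_of_poly 'X * F) n = if n is m.+1 then fps_coef F m else 0.
Proof.
rewrite fps_coefM; case: n => [|n]; first by rewrite big_ord1 /= coefX mul0r.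
rewrite !big_ord_recl big1 ?addr0 => [|i _]; last by rewrite /= coefX mul0r.
by rewrite /= !coefX mul0r add0r mul1r subSS subn0.
Qed.

End CoefficientwiseMorphisms.

Lemma fps_map_scalevar (R : comNzRingType) (A A' : comAlgType R)
    (phi : {lrmorphism A -> A'}) (c : A) (F : fps R) :
  fps_map phi (fps_scalevar c F) = fps_scalevar (phi c) F.
Proof. by apply/fpsP => n; rewrite /= linearZ rmorphXn. Qed.

Lemma fps_scalevar_1DX (R : comNzRingType) (A : comAlgType R) (c : A) :
  fps_scalevar c (fps_of_poly (1 + 'X)) = fps_of_poly (1 + c *: 'X).
Proof.
apply/fpsP => n; rewrite /= !coefD coefZ !coef1 !coefX.
case: n => [|[|n]] /=; rewrite ?(mulr0, mulr1, addr0, add0r) ?scale1r //.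
by rewrite scale0r.
Qed.

(* The derivation t d/dt; unlike d/dt it does not shift indices. *)
Definition fps_theta (R : comNzRingType) (F : fps R) : fps R :=
  FPS (fun n => n%:R * fps_coef F n).

Section LogarithmicDerivative.
Variable R : comNzRingType.
Implicit Types (F G B : fps R) (n : nat).

Lemma fps_thetaM F G : fps_theta (F * G) = fps_theta F * G + F * fps_theta G.
Proof.
apply/fpsP => n; rewrite /= mulr_sumr -big_split /=.
apply: eq_bigr => i _; rewrite -{1}(subnKC (ltnSE (ltn_ord i))) natrD mulrDl.
by rewrite mulrA [in X in _ + X]mulrCA.
Qed.

Lemma fps_theta1 : fps_theta (1 : fps R) = 0.
Proof. by apply/fpsP => -[|n] /=; rewrite ?mul0r ?mulr0. Qed.

Lemma fps_theta_negvar F : fps_theta (fps_negvar F) = fps_negvar (fps_theta F).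
Proof. by apply/fpsP => n /=; rewrite mulrCA. Qed.

Lemma fps_theta_map (S : comNzRingType) (phi : {rmorphism R -> S}) F :
  fps_theta (fps_map phi F) = fps_map phi (fps_theta F).
Proof. by apply/fpsP => n; rewrite /= rmorphM rmorph_nat. Qed.

Lemma fps_theta_scalevar (A : comAlgType R) (c : A) F :
  fps_theta (fps_scalevar c F) = fps_scalevar c (fps_theta F).
Proof. by apply/fpsP => n; rewrite /= -scalerA scaler_nat mulr_natl. Qed.

Lemma fps_theta_prod I (r : seq I) (P : pred I) (F B : I -> fps R) :
    (forall i, fps_theta (F i) = B i * F i) ->
  fps_theta (\prod_(i <- r | P i) F i) =
  (\sum_(i <- r | P i) B i) * \prod_(i <- r | P i) F i.
Proof.
move=> thetaF; elim/big_rec2: _ => [|i f b _ thetaf].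
  by rewrite fps_theta1 mul0r.
by rewrite fps_thetaM thetaF thetaf mulrDl -mulrA [F i * (_ * _)]mulrCA.
Qed.

Lemma fps_theta_inv F G B : F * G = 1 -> fps_theta F = B * F ->
  fps_theta G = - B * G.
Proof.
move=> FG thetaF; have := fps_thetaM F G.
rewrite FG fps_theta1 thetaF -mulrA FG mulr1 => /esym/eqP.
rewrite addrC addr_eq0 => /eqP/(congr1 ( *%R G)).
by rewrite mulrA [G * F]mulrC FG mul1r mulrC.
Qed.

Lemma fps_theta_coef0 F B : fps_coef F 0 = 1 -> fps_theta F = B * F ->
  fps_coef B 0 = 0.
Proof.
move=> F0 /(congr1 (fun G => fps_coef G 0)).
by rewrite fps_coef0M /= F0 !mulr1 => <-.
Qed.

End LogarithmicDerivative.

Lemma fps_theta_inj (K : fieldType) (A : comAlgType K) (F G : fps A) :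
    [pchar K] =i pred0 -> fps_coef F 0 = fps_coef G 0 ->
  fps_theta F = fps_theta G -> F = G.
Proof.
move=> /pcharf0P char0 FG0 thetaFG; apply/fpsP => -[|n]; first exact: FG0.
have := congr1 (fun U => fps_coef U n.+1) thetaFG.
rewrite /= !mulr_natl -!scaler_nat; apply: scalerI.
by rewrite char0.
Qed.

Lemma exists_low_monom (A : monom) : exists N, low N A.
Proof.
exists (\max_(i <- A) i).+1; apply/allP => i iA.
by rewrite ltnS (@leq_bigmax_seq _ _ _ id).
Qed.

Lemma low_leq M N (A : monom) : (M <= N)%N -> low M A -> low N A.
Proof. by move=> MN /allP lowA; apply/allP => i /lowA /leq_trans; apply. Qed.

Lemma eq_msetn (T : choiceType) k (x y : T) : (0 < k)%N ->
  (msetn k x == msetn k y) = (x == y).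
Proof.
move=> k_gt0; apply/eqP/eqP => [/msetP/(_ x)|->//].
by rewrite msetnxx msetnE; case: eqP => // _ k0; rewrite k0 in k_gt0.
Qed.

Lemma monom_perm_eq_msetn s k i (A : monom) : injective s ->
  (monom_perm s A == msetn k (s i)) = (A == msetn k i).
Proof.
move=> s_inj; apply/eqP/eqP => [sA|->]; apply/msetP => x.
  by rewrite -(monom_permE A x s_inj) sA !msetnE (inj_eq s_inj).
by rewrite /monom_perm enum_msetn map_nseq -enum_msetn seq_mset_id.
Qed.

Section SproutSeries.
Variable R : comNzRingType.
Implicit Types (F G : fps R) (T : fps (symfun R)).

Definition symtrunc N : symfun R -> mfps R := trunc N \o @symfun_val R.
HB.instance Definition _ N := GRing.LRMorphism.on (symtrunc N).

Lemma symtrunc_inj (f g : symfun R) :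
  (forall N, symtrunc N f = symtrunc N g) -> f = g.
Proof.
move=> eqfg; apply/symfunP => A; have [N lowA] := exists_low_monom A.
by have := congr1 (fun h => mcf h A) (eqfg N); rewrite /= lowA.
Qed.

Lemma fps_map_symtrunc_inj T T' :
  (forall N, fps_map (symtrunc N) T = fps_map (symtrunc N) T') -> T = T'.
Proof.
move=> eqTT'; apply/fpsP => n; apply: symtrunc_inj => N.
exact: (congr1 (fun U => fps_coef U n) (eqTT' N)).
Qed.

Lemma trunc_mfps_var N i :
  trunc N (mfps_var R i) = if (i < N)%N then mfps_var R i else 0.
Proof.
apply/mfpsP => A /=; have low_var : low N [mset i]%mset = (i < N)%N.
  by rewrite /low (enum_msetn 1) /= andbT.
have [->|nA] := eqVneq A [mset i]%mset.
  by rewrite low_var; case: ifP => //= _; rewrite eqxx.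
by case: ifP; case: ifP => //=; rewrite (negbTE nA).
Qed.

Lemma trunc_prod_scalevar F M N : fps_coef F 0 = 1 -> (N <= M)%N ->
  fps_map (trunc N) (\prod_(i < M) fps_scalevar (mfps_var R i) F) =
  \prod_(i < N) fps_scalevar (mfps_var R i) F.
Proof.
move=> F0 NM; pose Fx i := fps_scalevar (mfps_var R i) F.
rewrite rmorph_prod (big_ord_widen M Fx NM) [RHS]big_mkcond /=.
apply: eq_bigr => i _; rewrite fps_map_scalevar /= trunc_mfps_var.
by case: ifP => // _; rewrite fps_scalevar0.
Qed.

(* T = \prod_i F(x_i t), tested on the first N variables for every N, where the
   product is finite. *)
Definition sprout_series F T := forall N,
  fps_map (symtrunc N) T = \prod_(i < N) fps_scalevar (mfps_var R i) F.

Lemma sprout_series_coef0 F T :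
  fps_coef F 0 = 1 -> sprout_series F T -> fps_coef T 0 = 1.
Proof.
move=> F0 sproutT; apply: symtrunc_inj => N; rewrite rmorph1.
transitivity (fps_coef (fps_map (symtrunc N) T) 0); first by [].
rewrite sproutT (big_morph (fun U => fps_coef U 0) (@fps_coef0M _) (erefl _)).
by apply: big1 => i _; rewrite /= F0 scale1r.
Qed.

Lemma sprout_seqP F (S : nat -> symfun R) : fps_coef F 0 = 1 ->
  sprout_seq F S <-> sprout_series F (FPS S).
Proof.
move=> F0; split=> [[_ _ prodS] N|sproutS].
  apply/fpsP => n; apply/mfpsP => A; have [M0 prodSnA] := prodS n A.
  rewrite -(trunc_prod_scalevar F0 (leq_maxr M0 N)) /=.
  by rewrite (prodSnA _ (leq_maxl M0 N)).
split=> [//||n A]; first exact: sprout_series_coef0 sproutS.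
have [N0 lowA] := exists_low_monom A; exists N0 => N N0N.
by rewrite -sproutS /= (low_leq N0N lowA).
Qed.

Lemma sprout_series_negvar F T :
  sprout_series F T -> sprout_series (fps_negvar F) (fps_negvar T).
Proof.
move=> sproutT N; rewrite fps_map_negvar sproutT rmorph_prod.
by apply: eq_bigr => i _; rewrite fps_scalevar_negvar.
Qed.

Lemma sprout_series_inv F G T T' : F * G = 1 -> T * T' = 1 ->
  sprout_series F T -> sprout_series G T'.
Proof.
move=> FG TT' sproutT N.
have <- : (fps_map (symtrunc N) T)^-1 = fps_map (symtrunc N) T'.
  by apply: mulr1_eq; rewrite -rmorphM TT' rmorph1.
apply: mulr1_eq; rewrite sproutT -big_split big1 //= => i _.
by rewrite -rmorphM FG rmorph1.
Qed.

Lemma sprout_series_syme : sprout_series (fps_of_poly (1 + 'X)) (FPS (syme R)).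
Proof.
move=> N; apply/fpsP => k; rewrite [LHS]trunc_syme.
under eq_bigr => i _ do rewrite fps_scalevar_1DX addrC.
rewrite -rmorph_prod /= bigA_distr coef_sum rmorph_sum big_mkcond.
apply: eq_bigr => J _; rewrite -big_mkcond scaler_prodr coefZ coefXn eq_sym.
case: eqP => _; last by rewrite mulr0.
by rewrite mulr1 rmorph_prod; apply: eq_bigr => i _; apply: mpevX.
Qed.

End SproutSeries.

Section PowerSums.
Variable R : comNzRingType.
Implicit Types (F B : fps R) (k : nat).

(* p_k = \sum_i x_i ^ k; since no i occurs in the empty monomial, p_0 = 0. *)
Definition symp_mfps k : mfps R :=
  MFPS (fun A => (has (fun i => A == msetn k i) A)%:R).

Fact symp_subproof k : symp_mfps k \in @symfun_pred R.
Proof.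
apply/symfun_predP; split=> [s bs A|] /=; last first.
  exists k => A kA /=; case: hasP => // -[i _ /eqP AE].
  by rewrite AE enum_msetn size_nseq ltnn in kA.
rewrite (eq_has_r (perm_mem (perm_eq_seq_mset _))) has_map.
congr (nat_of_bool _)%:R; apply: eq_has => i /=.
exact/monom_perm_eq_msetn/bij_inj.
Qed.

Definition symp k : symfun R := SymFun (symp_subproof k).

Lemma symp0 : symp 0 = 0.
Proof.
apply/symfunP => A /=; case: hasP => // -[i + /eqP AE].
by rewrite AE msetn0 in_mset0.
Qed.

Lemma symtrunc_symp N k : (0 < k)%N ->
  symtrunc N (symp k) = \sum_(i < N) mfps_var R i ^+ k.
Proof.
move=> k_gt0; apply/mfpsP => A.
rewrite (big_morph (fun f => mcf f A) (id1 := 0) (op1 := +%R)) //=.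
under eq_bigr => i _ do rewrite -mfpsXn /=.
have [/hasP[j _ /eqP ->]|/hasPn nA] := boolP (has _ _).
  rewrite /low enum_msetn all_nseq gtn_eqF //=.
  under eq_bigr => i _ do rewrite eq_msetn // eq_sym.
  rewrite -(big_ord1_eq +%R (fun=> 1)) [LHS]big_mkcond.
  by apply: eq_bigr => i _; case: eqP.
rewrite if_same big1 // => i _; case: eqP => // AE.
by have := nA i; rewrite AE in_msetn k_gt0 !eqxx => /(_ isT).
Qed.

(* The formal sum \sum_i B(x_i t), for B(0) = 0. *)
Definition symp_comb B : fps (symfun R) :=
  FPS (fun k => fps_coef B k *: symp k).

Lemma fps_map_symtrunc_symp_comb B N : fps_coef B 0 = 0 ->
  fps_map (symtrunc N) (symp_comb B) =
  \sum_(i < N) fps_scalevar (mfps_var R i) B.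
Proof.
move=> B0; apply/fpsP => k; rewrite fps_coef_sum [LHS]linearZ /=.
have [->|k_gt0] := posnP k.
  by rewrite B0 scale0r big1 // => i _; rewrite scale0r.
by rewrite symtrunc_symp // scaler_sumr.
Qed.

Lemma fps_theta_sprout F B T : fps_coef F 0 = 1 -> fps_theta F = B * F ->
  sprout_series F T -> fps_theta T = symp_comb B * T.
Proof.
move=> F0 thetaF sproutT; apply: fps_map_symtrunc_inj => N.
rewrite -fps_theta_map rmorphM /= !sproutT.
rewrite (fps_map_symtrunc_symp_comb _ (fps_theta_coef0 F0 thetaF)).
by apply: fps_theta_prod => i; rewrite fps_theta_scalevar thetaF rmorphM.
Qed.

Lemma negvar_symeM_symh : fps_negvar (FPS (syme R)) * FPS (symh R) = 1.
Proof.
apply/fpsP => -[|n]; first by rewrite fps_coef0M /= syme0 symh0 !mulr1.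
rewrite fps_coefM fps_coef1 -[RHS](@syme_symh R n.+1 isT).
by apply: eq_bigr => k _; rewrite scale_signr mulrA.
Qed.

Lemma fps_theta_1DX : fps_theta (fps_of_poly (1 + 'X : {poly R})) =
  - fps_negvar (FPS (fun k => (0 < k)%:R)) * fps_of_poly (1 + 'X).
Proof.
rewrite [RHS]mulrC rmorphD rmorph1 [RHS]mulrDl mul1r.
apply/fpsP => n; rewrite fps_coefD fps_coefXM /= coefX.
case: n => [|[|n]] /=.
- by rewrite !mulr0 mul0r oppr0 addr0.
- by rewrite !mulr0 oppr0 !(addr0, add0r) !mulr1 opprK.
- by rewrite addr0 mulr0 !mulr1 exprS mulN1r opprK subrr.
Qed.

Lemma fps_theta_syme :
  fps_theta (FPS (syme R)) = - fps_negvar (FPS symp) * FPS (syme R).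
Proof.
have seed0 : fps_coef (fps_of_poly (1 + 'X : {poly R})) 0 = 1.
  by rewrite /= coefD coef1 coefX addr0.
rewrite (fps_theta_sprout seed0 fps_theta_1DX (sprout_series_syme R)).
congr (_ * _); apply/fpsP => k /=; rewrite scaleNr -scalerA scale_signr.
by case: k => [|k]; rewrite ?symp0 ?scaler0 ?scale1r.
Qed.

Lemma fps_theta_symh : fps_theta (FPS (symh R)) = FPS symp * FPS (symh R).
Proof.
rewrite -[FPS symp]opprK; apply: fps_theta_inv negvar_symeM_symh _.
by rewrite fps_theta_negvar fps_theta_syme rmorphM rmorphN /= fps_negvarK.
Qed.

Lemma omega_symp_series :
  fps_map (omega R) (FPS symp) = - fps_negvar (FPS symp).
Proof.
have omegaH : fps_map (omega R) (FPS (symh R)) = FPS (syme R).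
  by apply/fpsP => n; apply: omega_symh.
have unitE : FPS (syme R) \is a GRing.unit.
  apply: (fps_unitPl (g := fps_negvar (FPS (symh R)))).
  rewrite mulrC -[FPS (syme R)]fps_negvarK -rmorphM.
  by rewrite negvar_symeM_symh rmorph1.
apply: (mulIr unitE); rewrite -fps_theta_syme -omegaH -rmorphM.
by rewrite -fps_theta_symh fps_theta_map.
Qed.

Lemma omega_symp_comb B :
  fps_map (omega R) (symp_comb B) = - fps_negvar (symp_comb B).
Proof.
apply/fpsP => k.
have /= omega_pk := congr1 (fun U => fps_coef U k) omega_symp_series.
by rewrite [LHS]linearZ /= omega_pk scalerN scalerAr.
Qed.

End PowerSums.

(* For the seed 1 + t this is the identity H(t) E(-t) = 1. *)
Lemma sprout_series_negvarM_omega (K : fieldType) (F : fps K)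
    (T : fps (symfun K)) :
    [pchar K] =i pred0 -> fps_coef F 0 = 1 -> sprout_series F T ->
  fps_negvar T * fps_map (omega K) T = 1.
Proof.
move=> char0 F0 sproutT; have T0 := sprout_series_coef0 F0 sproutT.
have unitF : F \is a GRing.unit by rewrite fps_unitE F0 unitr1.
have thetaF : fps_theta F = fps_theta F / F * F by rewrite mulrVK.
have thetaT := fps_theta_sprout F0 thetaF sproutT.
apply: (fps_theta_inj char0).
  by rewrite fps_coef0M fps_coef1 /= T0 rmorph1 !mulr1.
rewrite fps_theta1 fps_thetaM fps_theta_negvar fps_theta_map thetaT.
rewrite !rmorphM /= omega_symp_comb.
by rewrite mulNr mulrN [X in _ - X]mulrCA mulrA subrr.
Qed.

Theorem theorem2p6 (K : fieldType) (char0 : [pchar K] =i pred0)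
    (F : fps K) (F0 : fps_coef F 0 = 1)
    (S : nat -> symfun K) (sproutS : sprout_seq F S) :
  sprout_seq ((fps_negvar F)^-1) (fun n => omega K (S n)).
Proof.
have negF0 : fps_coef (fps_negvar F) 0 = 1 by rewrite /= F0 mulr1.
have negFV : fps_negvar F / fps_negvar F = 1.
  by rewrite mulrV // fps_unitE negF0 unitr1.
have V0 : fps_coef (fps_negvar F)^-1 0 = 1.
  have := congr1 (fun G => fps_coef G 0) negFV.
  by rewrite fps_coef0M negF0 mul1r.
have sproutT := (sprout_seqP S F0).1 sproutS.
apply/(sprout_seqP _ V0); apply: (sprout_series_inv negFV).
  exact: sprout_series_negvarM_omega char0 F0 sproutT.
exact: sprout_series_negvar.
Qed.
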